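(* Let $L$ be a coherent frame. (1) $L$ is $KL$-extremal if and only if every D-ideal of $KL$ is principal. (2) $L$ is $KL$-basic if and only if every countably generated D-ideal of $KL$ is principal. (3) $L$ is $KL$-coole if and only if every D-ideal of $KL$ is countably generated.
   Context: $KL$ is the poset of compact elements of a frame $L$; $L$ is coherent if $KL$ is a bounded sublattice of $L$ and every element of $L$ is a join of elements of $KL$. For a bounded meet-semilattice $A$, a subset $G\subseteq A$ is admissible if $\bigvee G$ exists in $A$ and for each $a\in A$ the join $\bigvee\{a\wedge y:y\in G\}$ exists in $A$ and equals $a\wedge\bigvee G$; a downset $E$ of $A$ is a D-ideal if $\bigvee G\in E$ for each admissible $G\subseteq E$; $D_\infty A$ is the frame of D-ideals under inclusion. A D-ideal is principal if it is of the form ${\downarrow}a$ with $a\in A$, and countably generated if it is the least D-ideal containing some countable subset of $A$. $A$ is identified with $\{{\downarrow}a:a\in A\}\subseteq D_\infty A$, and $D_\sigma A$ is the sub-$\sigma$-frame of $D_\infty A$ generated by $A$ (closure under finite meets and countable joins, computed in $D_\infty A$). For a frame $L$ with a bounded base $A$ closed under binary meets: $L$ is $A$-extremal if $A$ (in its own order) is a frame; $A$-basic if $A$ (in its own order) is a $\sigma$-frame, i.e. a bounded lattice with countable joins over which binary meets distribute; $A$-coole if $D_\sigma A=D_\infty A$. Here $A=KL$. *)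

(* Defs.v *)
From HB Require Import structures.
From mathcomp Require Import all_boot all_order.
From mathcomp Require Import all_classical.

Set Implicit Arguments.
Unset Strict Implicit.
Unset Printing Implicit Defensive.

Import Order.TTheory.
Local Open Scope classical_set_scope.
Local Open Scope order_scope.

(* Suprema are given relationally by [isLub]; they are always computed in the
   poset that is the type of the elements. *)

Section Distributivity.
Context {d : Order.disp_t} (A : tbMeetSemilatticeType d).

Definition meet_preserves_lub (G : set A) (s : A) : Prop :=
  forall a : A, isLub [set a `&` y | y in G] (a `&` s).

Definition is_frame : Prop :=
  (forall G : set A, exists s, isLub G s) /\
  (forall (G : set A) (s : A), isLub G s -> meet_preserves_lub G s).

(* [countable] means finite or denumerable. *)
Definition is_sigma_frame : Prop :=
  [/\ forall x y : A, exists s, isLub [set x; y] s,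
      forall G : set A, countable G -> exists s, isLub G s &
      forall (G : set A) (s : A),
        countable G -> isLub G s -> meet_preserves_lub G s].

Definition is_sub_sigma_frame (F : set A) : Prop :=
  [/\ F \top,
      forall x y : A, F x -> F y -> F (x `&` y) &
      forall (C : set A) (s : A), countable C -> C `<=` F -> isLub C s -> F s].

Definition admissible (G : set A) : Prop :=
  exists2 s, isLub G s & meet_preserves_lub G s.

Definition downset (E : set A) : Prop := forall x y : A, x <= y -> E y -> E x.

Definition is_dideal (E : set A) : Prop :=
  downset E /\
  forall (G : set A) (s : A), admissible G -> G `<=` E -> isLub G s -> E s.

End Distributivity.

HB.mixin Record isFrame d L of Order.TBLattice d L := {
  frame_axiom : is_frame L
}.

#[short(type="frameType")]
HB.structure Definition Frame d := { L of Order.TBLattice d L & isFrame d L }.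

Section DIdeals.
Context {d : Order.disp_t} (A : tbMeetSemilatticeType d).

Lemma is_dideal_down (a : A) : is_dideal [set x | x <= a].
Proof.
split=> [x y xy /(le_trans xy)//|G s _ Ga [_ sG]].
by apply: sG => x /Ga.
Qed.

Lemma is_didealI (E F : set A) :
  is_dideal E -> is_dideal F -> is_dideal (E `&` F)%classic.
Proof.
move=> [dE jE] [dF jF]; split=> [x y xy [/(dE _ _ xy) ? /(dF _ _ xy) ?] //|].
move=> G s admG GEF sG; split; [apply: jE sG | apply: jF sG] => //.
  by move=> x /GEF[].
by move=> x /GEF[].
Qed.

Lemma is_didealT : is_dideal [set: A].
Proof. by []. Qed.

Lemma is_dideal_bot (E : set A) : is_dideal E -> E \bot.
Proof.
have lub0 : isLub (@set0 A) \bot by split=> [x []|b _]; rewrite ?le0x.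
move=> [_ /(_ set0)]; apply=> //.
by exists \bot => // a; rewrite image_set0 meetx0.
Qed.

Record D_infty : Type := DIdeal {
  dideal_set : set A;
  _ : `[< is_dideal dideal_set >]
}.

HB.instance Definition _ := [isSub for dideal_set].
HB.instance Definition _ := [Choice of D_infty by <:].
HB.instance Definition _ :=
  [SubChoice_isSubPOrder of D_infty by <: with set_display].

Definition dideal (E : set A) (idE : is_dideal E) : D_infty :=
  DIdeal (asboolT idE).

Lemma dideal_setP (E : D_infty) : is_dideal (dideal_set E).
Proof. exact: asboolW (valP E). Qed.

Lemma le_dideal (E F : D_infty) :
  (E <= F) = (dideal_set E `<=` dideal_set F) :> Prop.
Proof. by rewrite -subsetEset. Qed.

Definition principal_dideal (a : A) : D_infty := dideal (is_dideal_down a).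

Definition meet_dideal (E F : D_infty) : D_infty :=
  dideal (is_didealI (dideal_setP E) (dideal_setP F)).

Fact dideal_lexI (E F G : D_infty) :
  (E <= meet_dideal F G) = (E <= F) && (E <= G).
Proof. exact: lexI. Qed.

Fact dideal_le0x (E : D_infty) : principal_dideal \bot <= E.
Proof.
rewrite le_dideal => x /= x0.
by apply: (dideal_setP E).1 x0 _; exact: is_dideal_bot (dideal_setP E).
Qed.

Fact dideal_lex1 (E : D_infty) : E <= dideal is_didealT.
Proof. by rewrite le_dideal. Qed.

HB.instance Definition _ :=
  Order.POrder_isMeetSemilattice.Build set_display D_infty dideal_lexI.
HB.instance Definition _ :=
  Order.hasBottom.Build set_display D_infty dideal_le0x.
HB.instance Definition _ :=
  Order.hasTop.Build set_display D_infty dideal_lex1.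

Fact is_dideal_smallest (S : set A) : is_dideal (smallest (@is_dideal d A) S).
Proof.
split=> [x y xy Sy I [idI SI]|G s admG GS sG I [idI SI]].
  by apply: idI.1 xy _; exact: Sy.
by apply: idI.2 admG _ sG => x /GS; apply.
Qed.

Fact is_dideal_arrow (E F : D_infty) :
  is_dideal [set x | forall y, dideal_set E y -> y <= x -> dideal_set F y].
Proof.
split=> [x z xz Fz y Ey yx|G s [t tG mG] GF sG y Ey ys].
  exact: Fz Ey (le_trans yx xz).
have ts : t = s by apply: le_anti; rewrite tG.2 ?sG.2//; case: sG tG => ? ? [].
rewrite {}ts in tG mG.
have yG : isLub [set y `&` x | x in G] y by have := mG y; rewrite (meet_l ys).
apply: (dideal_setP F).2 _ (yG); last first.
  move=> _ [x Gx <-]; apply: GF Gx _ _ (leIr _ _).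
  exact: (dideal_setP E).1 (leIl _ _) Ey.
exists y => // a; have := mG (a `&` y); rewrite -meetA (meet_l ys).
by rewrite image_comp (_ : _ \o _ = Order.meet (a `&` y))//;
  apply/funext => x /=; rewrite meetA.
Qed.

Lemma is_frame_D_infty : is_frame D_infty.
Proof.
split=> [G|G s [sG leG] E].
  exists (dideal (is_dideal_smallest (\bigcup_(E in G) dideal_set E)%classic)).
  split=> [E GE|F FG]; rewrite le_dideal => x /=.
    by move=> Ex I [_ GI]; apply: GI; exists E.
  apply; split=> [|y [E GE Ey]]; first exact: dideal_setP.
  by have := FG _ GE; rewrite le_dideal; apply.
split=> [_ [F GF <-]|F FG]; first by rewrite leI2 ?lexx ?sG.
have : s <= dideal (is_dideal_arrow E F).
  apply: leG => H GH; rewrite le_dideal => x Hx y Ey yx.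
  have : E `&` H <= F by apply: FG; exists H.
  rewrite le_dideal; apply; split=> //.
  exact: (dideal_setP H).1 yx Hx.
by rewrite !le_dideal => sF y [Ey /sF]; apply.
Qed.

Definition principal (E : D_infty) : Prop := exists a, E = principal_dideal a.

Definition generated_by (E : D_infty) (S : set A) : Prop :=
  S `<=` dideal_set E /\
  forall F : D_infty, S `<=` dideal_set F -> E <= F.

Definition countably_generated (E : D_infty) : Prop :=
  exists2 S : set A, countable S & generated_by E S.

Definition D_sigma : set D_infty :=
  smallest (@is_sub_sigma_frame _ D_infty) (range principal_dideal).

End DIdeals.

Arguments D_sigma {d} A _.

Section Bases.
Context {d : Order.disp_t} (L : frameType d).

Definition joins_of (B : set L) (x : L) : Prop :=
  exists2 S : set L, S `<=` B & isLub S x.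

(* A bounded base contains both bounds of L. *)
Record bounded_base := BoundedBase {
  base_set : set L;
  base0 : base_set \bot;
  base1 : base_set \top;
  baseI : forall x y, base_set x -> base_set y -> base_set (x `&` y);
  base_joins : forall x, joins_of base_set x
}.

Record base_elt (B : bounded_base) : Type := BaseElt {
  base_val : L;
  _ : `[< base_set B base_val >]
}.

Section BaseElt.
Variable B : bounded_base.

HB.instance Definition _ := [isSub of base_elt B for @base_val B].
HB.instance Definition _ := [Choice of base_elt B by <:].
HB.instance Definition _ :=
  [SubChoice_isSubPOrder of base_elt B by <: with d].

Definition to_base (x : L) (Bx : base_set B x) : base_elt B :=
  BaseElt (asboolT Bx).

Lemma base_eltP (x : base_elt B) : base_set B (base_val x).
Proof. exact: asboolW (valP x). Qed.

Definition meet_base (x y : base_elt B) : base_elt B :=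
  to_base (baseI (base_eltP x) (base_eltP y)).

Fact base_lexI (x y z : base_elt B) :
  (x <= meet_base y z) = (x <= y) && (x <= z).
Proof. exact: lexI. Qed.

Fact base_le0x (x : base_elt B) : to_base (base0 B) <= x.
Proof. exact: le0x. Qed.

Fact base_lex1 (x : base_elt B) : x <= to_base (base1 B).
Proof. exact: lex1. Qed.

HB.instance Definition _ :=
  Order.POrder_isMeetSemilattice.Build d (base_elt B) base_lexI.
HB.instance Definition _ := Order.hasBottom.Build d (base_elt B) base_le0x.
HB.instance Definition _ := Order.hasTop.Build d (base_elt B) base_lex1.

End BaseElt.

Definition extremal (B : bounded_base) : Prop := is_frame (base_elt B).

Definition basic (B : bounded_base) : Prop := is_sigma_frame (base_elt B).

Definition coole (B : bounded_base) : Prop :=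
  D_sigma (base_elt B) = [set: D_infty (base_elt B)].

Definition compact_elt (c : L) : Prop :=
  forall (S : set L) (s : L), isLub S s -> c <= s ->
    exists2 F : seq L, (forall x, x \in F -> S x) & c <= \join_(x <- F) x.

Record coherent : Prop := Coherent {
  compact0 : compact_elt \bot;
  compact1 : compact_elt \top;
  compactI : forall x y, compact_elt x -> compact_elt y ->
    compact_elt (x `&` y);
  compactU : forall x y, compact_elt x -> compact_elt y ->
    compact_elt (x `|` y);
  compact_joins : forall x, joins_of compact_elt x
}.

Definition KL (cohL : coherent) : bounded_base :=
  BoundedBase (compact0 cohL) (compact1 cohL) (compactI cohL)
    (compact_joins cohL).

End Bases.

(* Main.v *)
Require Import Defs.
From mathcomp Require Import all_boot all_order.
From mathcomp Require Import all_classical.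

(** The compact elements of a coherent frame form a bounded meet-semilattice,
    and the three equivalences are proved for every bounded meet-semilattice
    [A].

    The key fact is that the D-ideal generated by [G] is the principal one
    below [s] exactly when [s] is a join of [G] over which binary meets
    distribute ([generated_by_principalP]).  Hence all D-ideals (resp. all
    countably generated D-ideals) are principal iff all (resp. all countable)
    subsets of [A] have distributive joins, which is the frame (resp.
    sigma-frame) property.  This gives the first two parts.

    For the third part, D_sigma A consists exactly of the countably generated
    D-ideals ([D_sigmaE]).  A D-ideal generated by a countable [S] is the join
    of the principal D-ideals of the elements of [S], hence lies in D_sigma A.
    Conversely the countably generated D-ideals form a sub-sigma-frame: unions
    of generating sets generate joins, and pairwise meets of generators
    generate binary meets.

    Both facts rest on the residual [{x | a /\ x in H}] of a D-ideal [H] being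
    a D-ideal ([is_dideal_residual]): an inclusion [a /\ S <= H] then extends
    from a generating set [S] to the whole D-ideal it generates. *)

Set Implicit Arguments.
Unset Strict Implicit.
Unset Printing Implicit Defensive.

Import Order.TTheory.
Local Open Scope classical_set_scope.
Local Open Scope order_scope.

Section GeneratedDIdeals.
Context {d : Order.disp_t} (A : tbMeetSemilatticeType d).
Implicit Types (G S T : set A) (E F H : D_infty A) (a s x y : A).

Lemma isLub_uniq {d' : Order.disp_t} {P : porderType d'} (X : set P) (s t : P) :
  isLub X s -> isLub X t -> s = t.
Proof. by move=> [us ls] [ut lt]; apply: le_anti; rewrite ls// lt. Qed.

Lemma admissible_meet_preserves_lub G s :
  isLub G s -> admissible G -> meet_preserves_lub G s.
Proof. by move=> Gs [t Gt]; rewrite (isLub_uniq Gs Gt). Qed.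

(** Meeting with [a] preserves admissibility because the defining condition
    quantifies over all multipliers, in particular over those of the form
    [b /\ a]. *)
Lemma admissible_meet G a : admissible G -> admissible [set a `&` y | y in G].
Proof.
move=> [s _ mG]; exists (a `&` s) => // b.
rewrite meetA image_comp (_ : _ \o _ = Order.meet (b `&` a)); first exact: mG.
by apply/funext => y /=; rewrite meetA.
Qed.

Lemma is_dideal_residual H a : is_dideal [set x | dideal_set H (a `&` x)].
Proof.
split=> [x y xy|G s admG GH Gs].
  by apply: (dideal_setP H).1; rewrite leI2.
have mG := admissible_meet_preserves_lub Gs admG.
apply: (dideal_setP H).2 (admissible_meet a admG) _ (mG a).
by move=> _ [y Gy <-]; exact: GH.
Qed.

Lemma generated_by_meet E S H a : generated_by E S ->
  (forall x, S x -> dideal_set H (a `&` x)) ->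
  forall x, dideal_set E x -> dideal_set H (a `&` x).
Proof.
move=> [_ minE] SH; have := minE (dideal (is_dideal_residual H a)) SH.
by rewrite le_dideal.
Qed.

Lemma generated_by_ex S : exists E, generated_by E S.
Proof.
exists (dideal (is_dideal_smallest S)); split=> [x Sx I [_]|F SF]; first exact.
by rewrite le_dideal => x; apply; split=> //; exact: dideal_setP.
Qed.

Lemma generated_by_uniq S E F : generated_by E S -> generated_by F S -> E = F.
Proof. by move=> [SE lE] [SF lF]; apply: le_anti; rewrite lE// lF. Qed.

Lemma principal_le a E : (principal_dideal a <= E) = dideal_set E a :> Prop.
Proof.
rewrite le_dideal propeqE; split=> [aE|Ea x /= xa].
  by apply: aE; exact: lexx.
exact: (dideal_setP E).1 xa Ea.
Qed.

(** From left to right, testing the generated D-ideal against the D-ideal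
    below [b] shows that [s] is a least upper bound; testing it against the
    residual of that D-ideal by [a] shows that the join is distributive. *)
Lemma generated_by_principalP G s :
  generated_by (principal_dideal s) G <->
  isLub G s /\ meet_preserves_lub G s.
Proof.
split=> [gen|[Gs mG]]; last first.
  split=> [|E GE]; first exact: Gs.1.
  by rewrite principal_le; apply: ((dideal_setP E).2 G) => //; exists s.
have sG a : isLub [set a `&` y | y in G] (a `&` s).
  split=> [_ [y Gy <-]|b ub]; first by rewrite leI2 ?lexx//; exact: gen.1 Gy.
  apply: (generated_by_meet (H := principal_dideal b) gen) => /=;
    last exact: lexx.
  by move=> x Gx; apply: ub; exists x.
split=> //; have := sG \top; rewrite meet1x.
by under eq_imagel do rewrite meet1x; rewrite image_id.
Qed.

Lemma principal_generatedP G E : generated_by E G ->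
  principal E <-> exists s, isLub G s /\ meet_preserves_lub G s.
Proof.
move=> gen; split=> [[s Es]|[s /generated_by_principalP gens]]; exists s.
  by apply/generated_by_principalP; rewrite -Es.
exact: generated_by_uniq gen gens.
Qed.

Lemma is_frame_principalP : is_frame A <-> forall E, principal E.
Proof.
split=> [[exA mA] E|prA].
  have genE : generated_by E (dideal_set E).
    by split=> // F; rewrite le_dideal.
  apply/(principal_generatedP genE).
  by have [s Es] := exA (dideal_set E); exists s; split=> //; exact: mA.
have lubA G : exists s, isLub G s /\ meet_preserves_lub G s.
  by have [E gen] := generated_by_ex G; exact/(principal_generatedP gen).
split=> [G|G s Gs]; first by have [s []] := lubA G; exists s.
by have [t [Gt]] := lubA G; rewrite (isLub_uniq Gs Gt).
Qed.

Lemma is_sigma_frame_principalP :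
  is_sigma_frame A <-> forall E, countably_generated E -> principal E.
Proof.
split=> [[_ exA mA] E [S cS genE]|prA].
  apply/(principal_generatedP genE).
  by have [s Ss] := exA _ cS; exists s; split=> //; exact: mA.
have lubA G : countable G -> exists s, isLub G s /\ meet_preserves_lub G s.
  move=> cG; have [E gen] := generated_by_ex G.
  by apply/(principal_generatedP gen)/prA; exists G.
split=> [x y|G cG|G s cG Gs].
- have [|s []] := lubA [set x; y]; last by exists s.
  exact/finite_set_countable/finite_set2.
- by have [s []] := lubA G cG; exists s.
- by have [t [Gt]] := lubA G cG; rewrite (isLub_uniq Gs Gt).
Qed.

Lemma countably_generated_principal a :
  countably_generated (principal_dideal a).
Proof.
exists [set a]; first exact/finite_set_countable/finite_set1.
split=> [_ -> /=|F aF]; first exact: lexx.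
by rewrite principal_le; exact: aF.
Qed.

Lemma generated_by_meet2 E F S T : generated_by E S -> generated_by F T ->
  generated_by (E `&` F) [set p.1 `&` p.2 | p in S `*` T].
Proof.
move=> genE genF; split=> [_ [[x y] /= [Sx Ty] <-]|H STH].
  split; first exact: (dideal_setP E).1 (leIl _ _) (genE.1 _ Sx).
  exact: (dideal_setP F).1 (leIr _ _) (genF.1 _ Ty).
rewrite le_dideal => z [Ez Fz]; rewrite -(meetxx z).
(* Extend the inclusion from S to E for fixed y in T, then from T to F. *)
apply: (generated_by_meet genF) Fz => y Ty.
rewrite meetC; apply: (generated_by_meet genE) Ez => x Sx.
by rewrite meetC; apply: STH; exists (x, y).
Qed.

Lemma generated_by_bigcup (C : set (D_infty A)) (g : D_infty A -> set A) F :
  (forall E, C E -> generated_by E (g E)) -> isLub C F ->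
  generated_by F (\bigcup_(E in C) g E).
Proof.
move=> genC [ubF lubF]; split=> [x [E CE gx]|H CH].
  have := ubF _ CE; rewrite le_dideal; apply.
  exact: (genC _ CE).1.
by apply: lubF => E CE; apply: (genC _ CE).2 => x gx; apply: CH; exists E.
Qed.

Lemma countably_generated_sub_sigma_frame :
  is_sub_sigma_frame (@countably_generated d A).
Proof.
split.
- have -> : \top = principal_dideal \top :> D_infty A.
    by apply: le_anti; rewrite lex1 andbT le_dideal => x _ /=; exact: lex1.
  exact: countably_generated_principal.
- move=> E F [S cS genE] [T cT genF].
  exists [set p.1 `&` p.2 | p in S `*` T]; last exact: generated_by_meet2.
  exact/(card_le_trans (card_image_le _ _))/countableX.
- move=> C F cC Ccg CF.
  have /choice[g gP] E : exists S, C E -> countable S /\ generated_by E S.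
    have [CE|nCE] := pselect (C E); last by exists set0.
    by have [S cS gS] := Ccg _ CE; exists S.
  exists (\bigcup_(E in C) g E).
    by apply: bigcup_countable => // E /gP[].
  by apply: generated_by_bigcup CF => E /gP[].
Qed.

Lemma isLub_principal E S :
  generated_by E S -> isLub [set principal_dideal x | x in S] E.
Proof.
move=> [SE minE]; split=> [_ [x Sx <-]|F ubF].
  by rewrite principal_le; exact: SE.
by apply: minE => x Sx; rewrite -principal_le; apply: ubF; exists x.
Qed.

Lemma D_sigmaE : D_sigma A = @countably_generated d A.
Proof.
rewrite eqEsubset; split=> [E|E [S cS genE]].
  apply; split; first exact: countably_generated_sub_sigma_frame.
  by move=> _ [a _ <-]; exact: countably_generated_principal.
move=> X [[_ _ lubX] AX].
apply: (lubX _ E _ _ (isLub_principal genE)).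
  exact: card_le_trans (card_image_le _ _) cS.
by move=> _ [x _ <-]; apply: AX; exists x.
Qed.

End GeneratedDIdeals.

Theorem theorem8p4 (d : Order.disp_t) (L : frameType d) (cohL : coherent L) :
  [/\ extremal (KL cohL) <->
        (forall E : D_infty (base_elt (KL cohL)), principal E),
      basic (KL cohL) <->
        (forall E : D_infty (base_elt (KL cohL)), countably_generated E -> principal E) &
      coole (KL cohL) <->
        (forall E : D_infty (base_elt (KL cohL)), countably_generated E)].
Proof.
split; first exact: is_frame_principalP.
  exact: is_sigma_frame_principalP.
rewrite /coole D_sigmaE; split=> [cgT E|cg]; first by rewrite cgT.
by apply/seteqP; split.
Qed.
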